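(* Let $K\ge 2$ and consider the Active Flux Petrov-Galerkin method with point value update $$\frac{\mathrm d}{\mathrm dt}q_{i+\frac12}+(\psi_{i+\frac12},\partial_xf(q_h))_{L^2}=0\qquad\forall i\in\mathbb Z$$ for linear $f$, where $\psi_{i+\frac12}$ is the biorthogonal test function with parameter $\alpha_{i+\frac12}\in\mathbb R$ and $q_h$ is the Active Flux numerical approximation. Then $(Dq_h)_{i+\frac12}:=(\psi_{i+\frac12},\partial_xq_h(t,\cdot))_{L^2}$ is the $\alpha$-upwinded average $$(Dq_h)_{i+\frac12}=\frac{d^+_{i+\frac12}+d^-_{i+\frac12}}{2}-\frac{\alpha_{i+\frac12}}{2}\left(d^-_{i+\frac12}-d^+_{i+\frac12}\right)$$ of the one-sided derivatives $$d^+_{i+\frac12}:=\lim_{\epsilon\searrow0}(\partial_xq_h)(t,x_{i+\frac12}-\epsilon),\qquad d^-_{i+\frac12}:=\lim_{\epsilon\searrow0}(\partial_xq_h)(t,x_{i+\frac12}+\epsilon).$$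
   Context: Grid: $\Delta x>0$, interfaces $x_{i+\frac12}$ ($i\in\mathbb Z$) with $x_{i+\frac12}-x_{i-\frac12}=\Delta x$, and cell centres $x_i=\frac12(x_{i-\frac12}+x_{i+\frac12})$. $\mathbb 1_I$ is the characteristic function of the set $I$, and $(u,v)_{L^2}=\int_{\mathbb R}u(x)v(x)\,\mathrm dx$ (applied componentwise if one argument is vector-valued). Local element: let $E=[-\frac{\Delta x}2,\frac{\Delta x}2]$, $V=P^K(E)$ (polynomials of degree at most $K$ on $E$), and let $(A_k)_{k=0,\dots,K-2}$ be a basis of $P^{K-2}$. The degrees of freedom are the linear functionals on $V$ $$\sigma_{\pm\frac12}(v)=v\left(\pm\tfrac{\Delta x}{2}\right),\qquad \sigma_k(v)=\int_E A_k(x)v(x)\,\mathrm dx,\quad k=0,\dots,K-2.$$ The local basis $\{B_{-\frac12},B_{+\frac12},B_0,\dots,B_{K-2}\}$ of $V$ is the dual one: $\sigma_r(B_s)=\delta_{rs}$ for all $r,s\in\{\pm\frac12,0,1,\dots,K-2\}$ (the indices $0,1,\dots,K-2$ refer to moments, the indices $\pm\frac12$ to point values). Global basis functions: $$\phi_i^{(k)}(x)=B_k(x-x_i)\,\mathbb 1_{[x_{i-\frac12},x_{i+\frac12}]}(x),$$ $$\phi_{i+\frac12}(x)=B_{+\frac12}(x-x_i)\,\mathbb 1_{[x_{i-\frac12},x_{i+\frac12})}(x)+B_{-\frac12}(x-x_{i+1})\,\mathbb 1_{[x_{i+\frac12},x_{i+\frac32}]}(x).$$ Numerical approximation: for the conservation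 law $\partial_tq+\partial_xf(q)=0$, $q\colon\mathbb R_0^+\times\mathbb R\to\mathbb R^m$, $f\colon\mathbb R^m\to\mathbb R^m$, $$q_h(t,x)=\sum_{i\in\mathbb Z}\Big(\phi_{i+\frac12}(x)q_{i+\frac12}(t)+\sum_{k=0}^{K-2}\phi_i^{(k)}(x)q_i^{(k)}(t)\Big).$$ It is continuous in $x$ and a polynomial of degree at most $K$ in each cell; $\partial_xq_h$ is taken in the interior of each cell. Test functions: for $\alpha_{i+\frac12}\in\mathbb R$, the point value test function is supported in $[x_{i-\frac12},x_{i+\frac32}]$, equals $A_{+\frac12}(x-x_i)$ on $(x_{i-\frac12},x_{i+\frac12})$ and $A_{-\frac12}(x-x_{i+1})$ on $(x_{i+\frac12},x_{i+\frac32})$, where $A_{\pm\frac12}\in P^K(E)$ are the (unique) polynomials, depending on $\alpha_{i+\frac12}$, with $$\int_EA_{+\frac12}B_{+\frac12}\,\mathrm dx=\tfrac12+\tfrac{\alpha_{i+\frac12}}2,\qquad\int_EA_{-\frac12}B_{-\frac12}\,\mathrm dx=\tfrac12-\tfrac{\alpha_{i+\frac12}}2,$$ $$\int_EA_{+\frac12}B_{-\frac12}\,\mathrm dx=\int_EA_{-\frac12}B_{+\frac12}\,\mathrm dx=0,\qquad\int_EA_{\pm\frac12}B_k\,\mathrm dx=0,\quad k=0,\dots,K-2.$$ ($A_{\pm\frac12}$ are not to be confused with the moment polynomials $A_k$, $k=0,\dots,K-2$.) The test function $\psi_{i+\frac12}$ then satisfies $(\psi_{i+\frac12},\phi_{j+\frac12})_{L^2}=\delta_{ij}$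 and $(\psi_{i+\frac12},\phi_j^{(k)})_{L^2}=0$ for all $j$, $k$. *)

(* Defs.v *)
From mathcomp Require Export all_boot all_order all_algebra.
From mathcomp Require Export qpoly.
From mathcomp Require Export all_classical all_reals all_analysis.

Set Implicit Arguments.
Unset Strict Implicit.
Unset Printing Implicit Defensive.

Export Order.TTheory GRing.Theory Num.Theory.
Export numFieldNormedType.Exports.

Local Open Scope classical_set_scope.
Local Open Scope ring_scope.

(* Half-integer indices are shifted down: a family [u : int -> _] of interface
   quantities has [u i] standing for u_{i+1/2}; in particular [xI i] is
   x_{i+1/2} and [xI (i - 1)] is x_{i-1/2}. *)
Definition is_grid (R : realType) (dx : R) (xI : int -> R) : Prop :=
  0 < dx /\ forall i, xI i - xI (i - 1) = dx.

Definition center (R : realType) (xI : int -> R) (i : int) : R :=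
  (xI (i - 1) + xI i) / 2.

Definition L2prod (R : realType) (u v : R -> R) : R :=
  \int[lebesgue_measure]_x (u x * v x).

Definition L2prodv (R : realType) m (u : R -> R) (v : R -> 'cV[R]_m) : 'cV[R]_m :=
  \col_j L2prod u (fun x => v x j 0).

Definition cellE (R : realType) (dx : R) : set R := `[- (dx / 2), dx / 2].

Definition intE (R : realType) (dx : R) (p q : {poly R}) : R :=
  \int[lebesgue_measure]_(x in cellE dx) (p.[x] * q.[x]).

(* The K + 1 degrees of freedom: -1/2, +1/2, and the moments 0, ..., K-2
   (note #|'I_K.-1| = K - 1). *)
Notation dof K := (bool + 'I_K.-1)%type.

Definition ptL K : dof K := inl false.
Definition ptR K : dof K := inl true.
Definition mom K (k : 'I_K.-1) : dof K := inr k.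

(* P^n is [{poly_n.+1 R}]: in MathComp the index bounds the size, that is the
   degree plus one.  Hence P^{K-2} is [{poly_K.-1 R}]. *)
Definition sigma (R : realType) (K : nat) (dx : R)
    (A : K.-1.-tuple {poly_K.-1 R}) (r : dof K) (v : {poly_K.+1 R}) : R :=
  match r with
  | inl false => (v : {poly R}).[- (dx / 2)]
  | inl true => (v : {poly R}).[dx / 2]
  | inr k => intE dx (tnth A k) v
  end.

Definition is_dual_basis (R : realType) (K : nat) (dx : R)
    (A : K.-1.-tuple {poly_K.-1 R}) (B : dof K -> {poly_K.+1 R}) : Prop :=
  forall r s, sigma dx A r (B s) = (r == s)%:R.

Definition phi_mom (R : realType) (K : nat) (xI : int -> R)
    (B : dof K -> {poly_K.+1 R}) (i : int) (k : 'I_K.-1) (x : R) : R :=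
  (B (mom k) : {poly R}).[x - center xI i] * \1_(`[xI (i - 1), xI i]) x.

Definition phi_pt (R : realType) (K : nat) (xI : int -> R)
    (B : dof K -> {poly_K.+1 R}) (i : int) (x : R) : R :=
  (B (ptR K) : {poly R}).[x - center xI i] * \1_(`[xI (i - 1), xI i[) x
  + (B (ptL K) : {poly R}).[x - center xI (i + 1)] * \1_(`[xI i, xI (i + 1)]) x.

(* [\sum_(i \in [set: int])] is the finitely supported sum: for each x, at most
   two consecutive cells and three interfaces contribute. *)
Definition af_approx (R : realType) (K m : nat) (xI : int -> R)
    (B : dof K -> {poly_K.+1 R}) (qpt : R -> int -> 'cV[R]_m)
    (qmom : R -> int -> 'I_K.-1 -> 'cV[R]_m) (t x : R) : 'cV[R]_m :=
  \sum_(i \in [set: int])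
    (phi_pt xI B i x *: qpt t i
     + \sum_(k < K.-1) phi_mom xI B i k x *: qmom t i k).

Definition cell_interiors (R : realType) (xI : int -> R) : set R :=
  [set x | exists i : int, x \in `]xI (i - 1), xI i[].

(* Componentwise derivative in the cell interiors; the value at the interfaces
   (a null set) is immaterial and set to 0. *)
Definition cellwise_deriv (R : realType) m (xI : int -> R) (v : R -> 'cV[R]_m)
    (x : R) : 'cV[R]_m :=
  \col_j (if x \in cell_interiors xI then derive1 (fun y => v y j 0) x else 0).

Definition test_pair (R : realType) (K : nat) (dx : R)
    (B : dof K -> {poly_K.+1 R}) (a : R) (AR AL : {poly_K.+1 R}) : Prop :=
  [/\ intE dx AR (B (ptR K)) = 1 / 2 + a / 2,
      intE dx AL (B (ptL K)) = 1 / 2 - a / 2,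
      intE dx AR (B (ptL K)) = 0,
      intE dx AL (B (ptR K)) = 0 &
      forall k, intE dx AR (B (mom k)) = 0 /\ intE dx AL (B (mom k)) = 0].

(* The values of [psi] at the three interfaces of its support are left free. *)
Definition is_test_function (R : realType) (K : nat) (dx : R) (xI : int -> R)
    (B : dof K -> {poly_K.+1 R}) (a : R) (i : int) (psi : R -> R) : Prop :=
  exists AR AL : {poly_K.+1 R},
    [/\ test_pair dx B a AR AL,
        forall x, x \notin `[xI (i - 1), xI (i + 1)] -> psi x = 0,
        forall x, x \in `]xI (i - 1), xI i[ ->
          psi x = (AR : {poly R}).[x - center xI i] &
        forall x, x \in `]xI i, xI (i + 1)[ ->
          psi x = (AL : {poly R}).[x - center xI (i + 1)]].

(* d/dt q_{i+1/2} + (psi_{i+1/2}, d/dx f(q_h)) = 0 for all i and all t > 0. *)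
Definition point_value_update (R : realType) (K m : nat) (xI : int -> R)
    (B : dof K -> {poly_K.+1 R}) (f : 'cV[R]_m -> 'cV[R]_m)
    (psi : int -> R -> R) (qpt : R -> int -> 'cV[R]_m)
    (qmom : R -> int -> 'I_K.-1 -> 'cV[R]_m) : Prop :=
  forall (t : R) (i : int) (j : 'I_m), 0 < t ->
    derivable (fun s => qpt s i j 0) t 1 /\
    derive1 (fun s => qpt s i j 0) t
    + L2prodv (psi i)
        (cellwise_deriv xI (fun x => f (af_approx xI B qpt qmom t x))) j 0 = 0.

Definition D_af (R : realType) (m : nat) (xI : int -> R) (psi : int -> R -> R)
    (v : R -> 'cV[R]_m) (i : int) : 'cV[R]_m :=
  L2prodv (psi i) (cellwise_deriv xI v).

(* Beware of the superscripts: d^+ is the derivative from the left of the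
   interface and d^- the one from the right. *)
Definition dplus_at (R : realType) m (xI : int -> R) (v : R -> 'cV[R]_m)
    (i : int) (j : 'I_m) (eps : R) : R := cellwise_deriv xI v (xI i - eps) j 0.

Definition dminus_at (R : realType) m (xI : int -> R) (v : R -> 'cV[R]_m)
    (i : int) (j : 'I_m) (eps : R) : R := cellwise_deriv xI v (xI i + eps) j 0.

Definition dplus (R : realType) m (xI : int -> R) (v : R -> 'cV[R]_m)
    (i : int) : 'cV[R]_m :=
  \col_j lim (dplus_at xI v i j eps @[eps --> 0^'+]).

Definition dminus (R : realType) m (xI : int -> R) (v : R -> 'cV[R]_m)
    (i : int) : 'cV[R]_m :=
  \col_j lim (dminus_at xI v i j eps @[eps --> 0^'+]).

(* Main.v *)
From HB Require Import structures.
Require Import Defs.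
From mathcomp Require Import ring lra zify.

(** In the open cell ]x_{c-1/2}, x_{c+1/2}[ the approximation [q_h] is a
    polynomial [P_c] of degree at most [K] in [x - x_c] ([af_approx_cell]), so
    its derivative there is [P_c'(x - x_c)] ([cellwise_deriv_cell]).  By
    continuity of polynomials the one-sided derivatives at x_{i+1/2} are
      d^+ = P_i'(dx/2)   and   d^- = P_{i+1}'(-dx/2)
    ([dplus_at_cvg], [dminus_at_cvg]).

    The derivative [P_c'] again has degree at most [K], and a family of [K + 1]
    polynomials dual to the [K + 1] degrees of freedom is a basis of that space:
    every [v] in it equals [\sum_r sigma_r(v) B_r] ([dual_basis_expand]).
    Integrating this expansion against [A_{+1/2}], which is orthogonal to all
    basis elements except [B_{+1/2}], keeps only the value of [v] at the right
    end point of the cell; likewise [A_{-1/2}] keeps only the value at the left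
    end point ([intE_test_pair]):
      \int_E A_{+1/2} v = (1 + alpha)/2 v(dx/2),
      \int_E A_{-1/2} v = (1 - alpha)/2 v(-dx/2).

    Up to a translation of each cell onto [E], the scalar product of the test
    function with the cellwise derivative is the sum of these two integrals for
    [v = P_i'] and [v = P_{i+1}'] ([L2prod_test_deriv]), that is
    (1 + alpha)/2 d^+ + (1 - alpha)/2 d^-, which is the upwinded average. *)

Set Implicit Arguments.
Unset Strict Implicit.
Unset Printing Implicit Defensive.

Local Open Scope classical_set_scope.
Local Open Scope ring_scope.

(** * Integrals of polynomials over intervals *)

Lemma horner_shift (R : comNzRingType) (p : {poly R}) (c x : R) :
  p.[x - c] = (p \Po ('X - c%:P)).[x].
Proof. by rewrite horner_comp !hornerE. Qed.

Section PolyIntegral.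
Variable R : realType.
Implicit Types (p q : {poly R}) (a b c : R).
Notation mu := (@lebesgue_measure R).

Lemma integrable_horner_itv (i j : bool) a b p :
  mu.-integrable [set` Interval (BSide i a) (BSide j b)] (EFin \o horner p).
Proof.
apply: (@integrableS _ _ _ mu `[a, b]%classic) => //.
- by apply: subset_itv; rewrite ?bnd_simp; case: i; case: j.
- apply: continuous_compact_integrable; first exact: segment_compact.
  by apply: continuous_subspaceT => x; exact: continuous_horner.
Qed.

Lemma Rintegral_horner_shift a b c p : a <= b ->
  \int[mu]_(x in `[a + c, b + c]) p.[x - c] = \int[mu]_(x in `[a, b]) p.[x].
Proof.
move=> ab; rewrite /Rintegral; congr fine.
(* the translation is written as a polynomial function, for the sake of its
   derivative and continuity *)
pose F : R -> R := horner ('X - c%:P).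
have FE x : F x = x - c by rewrite /F !hornerE.
have dF : derive1 F = cst 1.
  by rewrite /F -derivE derivXsubC; apply/funext => x; rewrite hornerC.
have cF : continuous F by exact: continuous_horner.
have := @integration_by_substitution_increasing R F (horner p) (a + c) (b + c).
rewrite !FE !addrK => ->.
- by apply: eq_integral => x _; rewrite dF !fctE FE mulr1.
- by rewrite lerD2r.
- by move=> x y _ _; rewrite !FE ltrD2r.
- by rewrite dF => ? _; exact: cvg_cst.
- by rewrite dF; exact: is_cvg_cst.
- by rewrite dF; exact: is_cvg_cst.
- split.
  + by move=> x _; exact: derivable_horner.
  + by apply: cvg_at_right_filter; exact: cF.
  + by apply: cvg_at_left_filter; exact: cF.
- by apply: continuous_subspaceT => x; exact: continuous_horner.
Qed.

Lemma Rintegral_horner_oo a b p :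
  \int[mu]_(x in `]a, b[) p.[x] = \int[mu]_(x in `[a, b]) p.[x].
Proof.
rewrite Rintegral_itv_obnd_cbnd ?Rintegral_itv_bndo_bndc//;
  exact: integrable_horner_itv.
Qed.

(** Since [g] is prescribed to be 0 also at [a], [b] and [c], it is determined
    everywhere and its measurability needs no separate hypothesis. *)
Lemma Rintegral_two_pieces (g : R -> R) (a b c : R) (p q : {poly R}) :
  (forall x, x \in `]a, b[ -> g x = p.[x]) ->
  (forall x, x \in `]b, c[ -> g x = q.[x]) ->
  (forall x, x \notin `]a, b[ -> x \notin `]b, c[ -> g x = 0) ->
  \int[mu]_x g x =
  \int[mu]_(x in `[a, b]) p.[x]
  + \int[mu]_(x in `[b, c]) q.[x].
Proof.
move=> gp gq g0; rewrite -!Rintegral_horner_oo.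
rewrite [X in _ = X + _]Rintegral_mkcond [X in _ = _ + X]Rintegral_mkcond.
rewrite -RintegralD//; last 2 first.
- by rewrite -restrict_EFin -integrable_mkcond//; exact: integrable_horner_itv.
- by rewrite -restrict_EFin -integrable_mkcond//; exact: integrable_horner_itv.
apply: eq_Rintegral => x _; rewrite /patch !mem_setE.
case: ifPn => xab; case: ifPn => xbc.
- move: xab xbc; rewrite !in_itv/= => /andP[_ xb] /andP[bx _].
  by have := lt_trans xb bx; rewrite ltxx.
- by rewrite gp// addr0.
- by rewrite gq// add0r.
- by rewrite g0// addr0.
Qed.

Lemma intE_horner dx p q : intE dx p q = \int[mu]_(x in cellE dx) (p * q).[x].
Proof. by apply: eq_Rintegral => x _; rewrite hornerM. Qed.

Lemma intED dx p q1 q2 : intE dx p (q1 + q2) = intE dx p q1 + intE dx p q2.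
Proof.
rewrite !intE_horner /cellE -RintegralD//; do ?exact: integrable_horner_itv.
by apply: eq_Rintegral => x _; rewrite mulrDr hornerD.
Qed.

Lemma intEZ dx p k q : intE dx p (k *: q) = k * intE dx p q.
Proof.
rewrite !intE_horner /cellE -RintegralZl//; last exact: integrable_horner_itv.
by apply: eq_Rintegral => x _; rewrite -scalerAr hornerZ.
Qed.

End PolyIntegral.

(** * Expansion in the dual basis *)

Section DualBasis.
Variables (R : realType) (K : nat) (dx : R).
Variable A : K.-1.-tuple {poly_K.-1 R}.
Variable B : dof K -> {poly_K.+1 R}.

Lemma sigma_is_linear r : linear (sigma dx A r : {poly_K.+1 R} -> R^o).
Proof.
move=> k u v; case: r => [[]|l] /=; rewrite ?hornerD ?hornerZ//.
by rewrite intED intEZ.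
Qed.

HB.instance Definition _ r :=
  GRing.isLinear.Build R {poly_K.+1 R} R^o _
    (sigma dx A r : {poly_K.+1 R} -> R^o) (sigma_is_linear r).

(** Duality makes the [K + 1] polynomials [B_r] linearly independent, hence a
    basis of [P^K] by dimension count. *)
Lemma dual_basis_expand (v : {poly_K.+1 R}) :
  (0 < K)%N -> is_dual_basis dx A B -> v = \sum_r sigma dx A r v *: B r.
Proof.
move=> K_gt0 dualB.
pose X := [tuple B (enum_val i) | i < #|{: dof K}|].
have XE (i : 'I_#|{: dof K}|) : X`_i = B (enum_val i).
  by rewrite -tnth_nth tnth_mktuple.
have sigma_sum s (c : 'I_#|{: dof K}| -> R) :
    sigma dx A s (\sum_i c i *: X`_i) = c (enum_rank s).
  rewrite (linear_sum (sigma dx A s : {poly_K.+1 R} -> R^o)).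
  rewrite (bigD1 (enum_rank s))//= big1 ?addr0 => [|i si].
    by rewrite linearZ/= XE enum_rankK dualB eqxx [LHS]mulr1.
  rewrite linearZ/= XE dualB; case: eqP => [sE|_]; last by rewrite [LHS]mulr0.
  by rewrite sE enum_valK eqxx in si.
have basisX : basis_of fullv X.
  have cardE : #|{: dof K}| = K.+1.
    by rewrite card_sum card_bool card_ord add2n prednK.
  rewrite basisEfree subvf dim_polyn size_tuple.
  rewrite [X in (_ <= X)%N]cardE leqnn !andbT.
  apply/freeP => c c0 i.
  by have := sigma_sum (enum_val i) c; rewrite c0 linear0 enum_valK.
rewrite [LHS](coord_basis basisX (memvf v)).
rewrite [RHS](reindex (@enum_val _ {: dof K}))/=; last first.
  exact/onW_bij/enum_val_bij.
apply: eq_bigr => i _; rewrite XE; congr (_ *: _).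
by rewrite [in RHS](coord_basis basisX (memvf v)) sigma_sum enum_valK.
Qed.

End DualBasis.

(** * The grid and the global basis functions *)

Section Grid.
Variables (R : realType) (dx : R) (xI : int -> R).
Hypothesis grid : is_grid dx xI.

Let dx_gt0 : 0 < dx. Proof. by case: grid. Qed.

Lemma grid_pred i : xI (i - 1) = xI i - dx.
Proof. by rewrite -(grid.2 i) subKr. Qed.

Lemma grid_succ i : xI (i + 1) = xI i + dx.
Proof. by rewrite -(grid.2 (i + 1)) addrK subrKC. Qed.

Lemma gridE i : xI i = xI 0 + i%:~R * dx.
Proof.
elim/int_rect: i => [|n ih|n ih]; first by rewrite mul0r addr0.
- by rewrite intS addrC grid_succ ih rmorphD/=; ring.
- by rewrite intS opprD addrC grid_pred ih rmorphB/=; ring.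
Qed.

Lemma grid_lt i j : (xI i < xI j) = (i < j).
Proof. by rewrite (gridE i) (gridE j) ltrD2l ltr_pM2r// ltr_int. Qed.

Lemma centerE i : center xI i = xI i - dx / 2.
Proof. by rewrite /center grid_pred; field. Qed.

Lemma center_succE i : center xI (i + 1) = xI i + dx / 2.
Proof. by rewrite centerE grid_succ; field. Qed.

(** A closed cell meets an open cell only if the two cells are the same. *)
Lemma cell_uniq (c i : int) x : x \in `]xI (c - 1), xI c[ ->
  (x \in `[xI (i - 1), xI i]) = (i == c).
Proof.
rewrite in_itv/= => /andP[cx xc]; apply/idP/eqP => [|->].
- rewrite in_itv/= => /andP[ix xi].
  have := lt_le_trans cx xi; have := le_lt_trans ix xc.
  by rewrite !grid_lt; lia.
- by rewrite in_itv/= !ltW.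
Qed.

Lemma cell_uniq_co (c i : int) x : x \in `]xI (c - 1), xI c[ ->
  (x \in `[xI (i - 1), xI i[) = (i == c).
Proof.
move=> xc; rewrite -(cell_uniq _ xc); apply/idP/idP.
- by rewrite !in_itv/= => /andP[-> /ltW].
- rewrite (cell_uniq _ xc) => /eqP ->; move: xc.
  by rewrite !in_itv/= => /andP[/ltW -> ->].
Qed.

Variables (K m : nat) (B : dof K -> {poly_K.+1 R}).
Variables (q : int -> 'cV[R]_m) (qk : int -> 'I_K.-1 -> 'cV[R]_m).

(** The polynomial that represents, in the local variable [x - x_c], the
    component [j] of the approximation on the cell [c], whose end points
    x_{c-1/2} and x_{c+1/2} carry the point values [q (c - 1)] and [q c]. *)
Definition cell_poly (c : int) (j : 'I_m) : {poly_K.+1 R} :=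
  q (c - 1) j 0 *: B (ptL K) + q c j 0 *: B (ptR K)
  + \sum_(k < K.-1) qk c k j 0 *: B (mom k).

Lemma phi_pt_cell (c i : int) x : x \in `]xI (c - 1), xI c[ ->
  phi_pt xI B i x = (B (ptR K) : {poly R}).[x - center xI c] *+ (i == c)
                  + (B (ptL K) : {poly R}).[x - center xI c] *+ (i == c - 1).
Proof.
move=> xc; rewrite /phi_pt !indicE !mem_setE (cell_uniq_co _ xc).
have -> : (x \in `[xI i, xI (i + 1)]) = (i == c - 1).
  by rewrite -{1}(addrK 1 i) (cell_uniq _ xc) [RHS]eq_sym subr_eq eq_sym.
rewrite !mulr_natr; congr (_ + _); first by case: eqP => [->|].
by case: eqP => [->|]; rewrite ?subrK.
Qed.

Lemma phi_mom_cell (c i : int) k x : x \in `]xI (c - 1), xI c[ ->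
  phi_mom xI B i k x =
  (B (mom k) : {poly R}).[x - center xI c] *+ (i == c).
Proof.
move=> xc; rewrite /phi_mom indicE mem_setE (cell_uniq _ xc) mulr_natr.
by case: eqP => [->|].
Qed.

End Grid.

(** * The approximation and its derivative in a cell *)

Section ApproxInCell.
Variables (R : realType) (dx : R) (xI : int -> R).
Hypothesis grid : is_grid dx xI.
Variables (K m : nat) (B : dof K -> {poly_K.+1 R}).
Variables (qpt : R -> int -> 'cV[R]_m).
Variable (qmom : R -> int -> 'I_K.-1 -> 'cV[R]_m).
Variable t : R.

Let qh := af_approx xI B qpt qmom t.
Let P := cell_poly B (qpt t) (qmom t).

Lemma af_approx_cell (c : int) x j : x \in `]xI (c - 1), xI c[ ->
  qh x j 0 = (P c j : {poly R}).[x - center xI c].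
Proof.
move=> xc; rewrite /qh /af_approx (@fsbigE _ _ _ _ _ [:: c - 1; c])//=.
- (* only the two end points of the cell c and the moments of the cell c
     contribute; the moments of the cell c - 1 do not *)
  rewrite (eq_bigl xpredT) => [|i]; last by rewrite in_setT.
  rewrite !big_cons big_nil addr0 !mxE !summxE.
  rewrite !(phi_pt_cell grid _ _ xc) !eqxx.
  have -> : (c - 1 == c) = false by lia.
  have -> : (c == c - 1) = false by lia.
  rewrite big1 => [|k _]; last first.
    rewrite mxE (phi_mom_cell grid _ _ _ xc).
    have -> : (c - 1 == c) = false by lia.
    by rewrite mul0r.
  rewrite !mulr0n !mulr1n add0r !addr0 /P /cell_poly/= !hornerD !hornerZ addrA.
  rewrite (mulrC (qpt t (c - 1) j 0)) (mulrC (qpt t c j 0)); congr (_ + _).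
  rewrite raddf_sum/= horner_sum; apply: eq_bigr => k _.
  by rewrite mxE (phi_mom_cell grid _ _ _ xc) eqxx hornerZ mulrC.
- by rewrite inE andbT; lia.
- move=> i _; rewrite !inE negb_or => /andP[ic1 ic].
  rewrite (phi_pt_cell grid _ _ xc) (negbTE ic1) (negbTE ic).
  rewrite addr0 scale0r add0r big1// => k _.
  by rewrite (phi_mom_cell grid _ _ _ xc) (negbTE ic) scale0r.
Qed.

Lemma cellwise_deriv_cell (c : int) x j : x \in `]xI (c - 1), xI c[ ->
  cellwise_deriv xI qh x j 0 = (P c j : {poly R})^`().[x - center xI c].
Proof.
move=> xc; rewrite mxE ifT; last by rewrite inE; exists c.
pose p := (P c j : {poly R}) \Po ('X - (center xI c)%:P).
rewrite derive1E (@near_eq_derive _ _ _ _ (horner p)).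
  by rewrite -derive1E -derivE deriv_comp derivXsubC mulr1 -horner_shift.
have : \forall y \near x, y \in `]xI (c - 1), xI c[ by exact: near_in_itvoo.
by apply: filterS => y yc; rewrite (af_approx_cell _ yc) horner_shift.
Qed.

Lemma cellwise_deriv_interface (c : int) j :
  cellwise_deriv xI qh (xI c) j 0 = 0.
Proof.
rewrite mxE ifF//; apply/negP; rewrite inE => -[i].
by rewrite in_itv/= !(grid_lt grid); lia.
Qed.

Lemma dplus_at_cvg (i : int) j :
  dplus_at xI qh i j eps @[eps --> 0^'+] --> (P i j : {poly R})^`().[dx / 2].
Proof.
have dx_gt0 : 0 < dx by case: grid.
pose p := (P i j : {poly R})^`() \Po ((dx / 2)%:P - 'X).
have pE y : p.[y] = (P i j : {poly R})^`().[xI i - y - center xI i].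
  rewrite horner_comp !hornerE (centerE grid); congr (_.[_]); ring.
have -> : (P i j : {poly R})^`().[dx / 2] = p.[0].
  by rewrite pE (centerE grid); congr (_.[_]); ring.
suff pd : \forall e \near 0^'+, p.[e] = dplus_at xI qh i j e.
  apply: cvg_trans (near_eq_cvg pd) _.
  exact: cvg_at_right_filter (@continuous_horner _ p 0).
near=> e; rewrite pE /dplus_at (@cellwise_deriv_cell i)//.
rewrite in_itv/= (grid_pred grid).
apply/andP; split; last by rewrite gtrBl.
by rewrite ltrD2l ltrN2.
Unshelve. all: by end_near. Qed.

Lemma dminus_at_cvg (i : int) j :
  dminus_at xI qh i j eps @[eps --> 0^'+] -->
    (P (i + 1) j : {poly R})^`().[- (dx / 2)].
Proof.
have dx_gt0 : 0 < dx by case: grid.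
pose p := (P (i + 1) j : {poly R})^`() \Po ('X - (dx / 2)%:P).
have pE y : p.[y] = (P (i + 1) j : {poly R})^`().[xI i + y - center xI (i + 1)].
  rewrite horner_comp !hornerE (center_succE grid); congr (_.[_]); ring.
have -> : (P (i + 1) j : {poly R})^`().[- (dx / 2)] = p.[0].
  by rewrite pE (center_succE grid); congr (_.[_]); ring.
suff pd : \forall e \near 0^'+, p.[e] = dminus_at xI qh i j e.
  apply: cvg_trans (near_eq_cvg pd) _.
  exact: cvg_at_right_filter (@continuous_horner _ p 0).
near=> e; rewrite pE /dminus_at (@cellwise_deriv_cell (i + 1))//.
rewrite in_itv/= addrK (grid_succ grid).
apply/andP; split; first by rewrite ltrDl.
by rewrite ltrD2l.
Unshelve. all: by end_near. Qed.

Lemma dplusE (i : int) j :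
  dplus xI qh i j 0 = (P i j : {poly R})^`().[dx / 2].
Proof. by rewrite mxE (cvg_lim _ (@dplus_at_cvg i j)). Qed.

Lemma dminusE (i : int) j :
  dminus xI qh i j 0 = (P (i + 1) j : {poly R})^`().[- (dx / 2)].
Proof. by rewrite mxE (cvg_lim _ (@dminus_at_cvg i j)). Qed.

End ApproxInCell.

(** * Testing the derivative *)

Section UpwindDerivative.
Variables (R : realType) (K m : nat) (dx : R) (xI : int -> R).
Hypothesis grid : is_grid dx xI.
Variables (A : K.-1.-tuple {poly_K.-1 R}) (B : dof K -> {poly_K.+1 R}).
Hypothesis dualB : is_dual_basis dx A B.
Hypothesis K_gt0 : (0 < K)%N.

(** On [P^K] the test polynomials act as weighted point evaluations at the two
    ends of the reference cell. *)
Lemma intE_test_pair (a : R) (AR AL : {poly_K.+1 R}) (v : {poly R}) :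
  test_pair dx B a AR AL -> (size v <= K.+1)%N ->
  intE dx AR v = (1 / 2 + a / 2) * v.[dx / 2] /\
  intE dx AL v = (1 / 2 - a / 2) * v.[- (dx / 2)].
Proof.
move=> [ARR ALL ARL ALR AM] sv.
have intE_sum (p : {poly R}) : intE dx p v =
    v.[- (dx / 2)] * intE dx p (B (ptL K)) + v.[dx / 2] * intE dx p (B (ptR K))
    + \sum_(k < K.-1) intE dx (tnth A k) v * intE dx p (B (mom k)).
  rewrite -(npolypK sv) {1}(dual_basis_expand (npolyp K.+1 v) K_gt0 dualB).
  have intE0 : intE dx p 0 = 0 by rewrite -(scale0r 0) intEZ mul0r.
  rewrite raddf_sum/= (big_morph (intE dx p) (intED dx p) intE0).
  rewrite big_sumType/= big_bool/=.
  rewrite !intEZ; congr (_ + _); first by rewrite addrC.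
  by apply: eq_bigr => k _; rewrite intEZ.
split; rewrite intE_sum big1 ?(ARR, ARL, ALR, ALL) => [|k _].
- by ring.
- by rewrite (AM k).1 [LHS]mulr0.
- by ring.
- by rewrite (AM k).2 [LHS]mulr0.
Qed.

Variables (qpt : R -> int -> 'cV[R]_m) (qmom : R -> int -> 'I_K.-1 -> 'cV[R]_m).
Variable t : R.
Let qh := af_approx xI B qpt qmom t.
Let P := cell_poly B (qpt t) (qmom t).

Lemma L2prod_test_deriv a (i : int) (psi : R -> R) (j : 'I_m) :
  is_test_function dx xI B a i psi ->
  L2prod psi (fun x => cellwise_deriv xI qh x j 0) =
    (1 / 2 + a / 2) * (P i j : {poly R})^`().[dx / 2]
    + (1 / 2 - a / 2) * (P (i + 1) j : {poly R})^`().[- (dx / 2)].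
Proof.
move=> [AR [AL [AP psi0 psiR psiL]]].
have dx_gt0 : 0 < dx by case: grid.
have sP c : (size ((P c j : {poly R})^`()) <= K.+1)%N.
  by rewrite (leq_trans (size_poly _ _))// (leq_trans (leq_pred _))// size_npoly.
rewrite -(intE_test_pair AP (sP i)).1 -(intE_test_pair AP (sP (i + 1))).2.
have i1 : i + 1 - 1 = i by rewrite addrK.
pose pR := (AR : {poly R}) * (P i j : {poly R})^`().
pose pL := (AL : {poly R}) * (P (i + 1) j : {poly R})^`().
rewrite /L2prod (@Rintegral_two_pieces _ _ (xI (i - 1)) (xI i) (xI (i + 1))
  (pR \Po ('X - (center xI i)%:P)) (pL \Po ('X - (center xI (i + 1))%:P))).
- have le_E : - (dx / 2) <= dx / 2 by lra.
  rewrite !intE_horner -/pR -/pL; congr (_ + _).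
  + rewrite -(Rintegral_horner_shift (center xI i) pR le_E) (grid_pred grid).
    have -> : - (dx / 2) + center xI i = xI i - dx.
      by rewrite (centerE grid); lra.
    have -> : dx / 2 + center xI i = xI i by rewrite (centerE grid); lra.
    by apply: eq_Rintegral => x _; rewrite horner_shift.
  + rewrite -(Rintegral_horner_shift (center xI (i + 1)) pL le_E).
    rewrite (grid_succ grid).
    have -> : - (dx / 2) + center xI (i + 1) = xI i.
      by rewrite (center_succE grid); lra.
    have -> : dx / 2 + center xI (i + 1) = xI i + dx.
      by rewrite (center_succE grid); lra.
    by apply: eq_Rintegral => x _; rewrite horner_shift.
- move=> x xi; rewrite psiR// -horner_shift hornerM.
  by rewrite (cellwise_deriv_cell grid _ _ _ _ _ xi).
- move=> x xi; rewrite psiL// -horner_shift hornerM.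
  by rewrite (cellwise_deriv_cell grid _ _ _ _ (c := i + 1)) ?i1.
- (* outside the two open cells either psi vanishes, or x is an interface,
     where the cellwise derivative is 0 by convention *)
  move=> x; rewrite !in_itv/= => xi xi1.
  have [xout|] := boolP (x \in `[xI (i - 1), xI (i + 1)]); last first.
    by move=> /psi0 ->; rewrite mul0r.
  suff [c ->] : exists c, x = xI c.
    by rewrite (cellwise_deriv_interface grid) mulr0.
  move: xout; rewrite in_itv/= => /andP[xge xle].
  move: xi xi1; rewrite !lt_neqAle xge xle !andbT !negb_and !negbK.
  have [/eqP <-|_] := boolP (xI (i - 1) == x); first by exists (i - 1).
  have [/eqP ->|_] := boolP (x == xI i); first by exists i.
  have [/eqP <-|_] := boolP (xI i == x); first by exists i.
  have [/eqP ->|_] := boolP (x == xI (i + 1)); first by exists (i + 1).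
  rewrite /= !orbF -!ltNge => h1 h2.
  by have := lt_trans h1 h2; rewrite ltxx.
Qed.

Lemma D_afE (psi : int -> R -> R) a (i : int) (j : 'I_m) :
  is_test_function dx xI B a i (psi i) ->
  D_af xI psi qh i j 0 =
    (1 / 2 + a / 2) * (P i j : {poly R})^`().[dx / 2]
    + (1 / 2 - a / 2) * (P (i + 1) j : {poly R})^`().[- (dx / 2)].
Proof. by move=> psiP; rewrite mxE; exact: L2prod_test_deriv. Qed.

End UpwindDerivative.

Theorem theorem2p3 (R : realType) (K m : nat) (hK : (2 <= K)%N)
    (dx : R) (xI : int -> R) (hgrid : is_grid dx xI)
    (A : K.-1.-tuple {poly_K.-1 R}) (hA : basis_of fullv A)
    (B : dof K -> {poly_K.+1 R}) (hB : is_dual_basis dx A B)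
    (alpha : int -> R) (psi : int -> R -> R)
    (hpsi : forall i, is_test_function dx xI B (alpha i) i (psi i))
    (f : {linear 'cV[R]_m -> 'cV[R]_m})
    (qpt : R -> int -> 'cV[R]_m) (qmom : R -> int -> 'I_K.-1 -> 'cV[R]_m)
    (hmethod : point_value_update xI B f psi qpt qmom)
    (t : R) (ht : 0 <= t) (i : int) :
  let qh := af_approx xI B qpt qmom t in
  [/\ forall j, cvg (dplus_at xI qh i j eps @[eps --> 0^'+]),
      forall j, cvg (dminus_at xI qh i j eps @[eps --> 0^'+]) &
      D_af xI psi qh i =
        2^-1 *: (dplus xI qh i + dminus xI qh i)
        - (alpha i / 2) *: (dminus xI qh i - dplus xI qh i)].
Proof.
move=> qh.
have cvg_plus j := @dplus_at_cvg R dx xI hgrid K m B qpt qmom t i j.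
have cvg_minus j := @dminus_at_cvg R dx xI hgrid K m B qpt qmom t i j.
split=> [j|j|]; [exact: cvgP (cvg_plus j)|exact: cvgP (cvg_minus j)|].
have dpE j : dplus xI qh i j 0 = _ := dplusE hgrid B qpt qmom t i j.
have dmE j : dminus xI qh i j 0 = _ := dminusE hgrid B qpt qmom t i j.
have DE j : D_af xI psi qh i j 0 = _ :=
  D_afE hgrid hB (ltnW hK) qpt qmom t j (hpsi i).
(* only the entries of the three vectors matter from here on *)
move: (D_af _ _ _ _) (dplus _ _ _) (dminus _ _ _) DE dpE dmE.
move=> D dp dm DE dpE dmE.
by apply/colP => j; rewrite !mxE DE dpE dmE; ring.
Qed.
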